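(* Let $y\in[0,\frac23]$ and let $k_n=\kappa_n(y)$, $n=0,1,2,\dots$. Put $$x=\sum_{n=1}^\infty2^{-l_n},\qquad l_n:=k_{n-1}+2(n-1),\quad n\in\mathbb{N},$$ where the term $2^{-l_n}$ is interpreted as $0$ when $k_{n-1}=\infty$. Then $T(x)=y$.
   Context: Let $\phi(x)=\operatorname{dist}(x,\mathbb{Z})$; the Takagi function is $T(x)=\sum_{n=0}^\infty 2^{-n}\phi(2^nx)$. Let $t_k=k/2^k$ for $k\in\mathbb{N}$, $I_2=[\frac12,\frac23]$, and $I_k=[t_k,t_{k-1})$ for $k\ge3$. Thus $[0,\frac23]$ is the disjoint union of $\{0\}$ and the $I_k$, $k\ge 2$. Define $\Psi:[0,\frac23]\to[0,\frac23]$ by $\Psi(0)=0$ and $\Psi(y)=4(y-t_k)$ if $y\in I_k$ ($k\ge 2$). $\Psi^n$ is the $n$-fold iterate, $\Psi^0(y)=y$. Define $\kappa:[0,\frac23]\to\{2,3,\dots,\infty\}$ by $\kappa(0)=\infty$ and $\kappa(y)=k$ if $y\in I_k$; and $\kappa_n(y)=\kappa(\Psi^n(y))$ for $n\ge0$. (The sequence $(k_n)$ is called the canonical Takagi expansion of $y$.) *)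

(* Defs.v *)
From HB Require Import structures.
From mathcomp Require Import all_boot all_order all_algebra.
From mathcomp Require Import all_classical all_reals all_analysis.
From mathcomp Require Import zify ring lra.
Set Implicit Arguments.
Unset Strict Implicit.
Unset Printing Implicit Defensive.
Import Order.TTheory GRing.Theory Num.Theory.
Import numFieldNormedType.Exports.
Local Open Scope classical_set_scope.
Local Open Scope ring_scope.

Definition distZ (R : realType) (x : R) : R :=
  inf [set `|x - m%:~R| | m in [set: int]].

(* The infinite sum is the limit in R of the partial sums; the series converges
   for every x since its terms are dominated by those of a geometric series. *)
Definition takagi (R : realType) (x : R) : R :=
  \big[+%R/0]_(0 <= n <oo) (2 ^- n * distZ (2 ^+ n * x)).

Definition tpt (R : realType) (k : nat) : R := k%:R / 2 ^+ k.

(* Only meaningful for [2 <= k]. *)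
Definition Iset (R : realType) (k : nat) : set R :=
  if k == 2%N then `[1 / 2, 2 / 3]%classic
  else `[tpt R k, tpt R k.-1[%classic.
Arguments Iset : clear implicits.

(* [None] stands for the value infinity.  On ]0, 2/3] exactly one k qualifies
   (see [kappaP]); outside [0, 2/3] the value is junk. *)
Definition kappa (R : realType) (y : R) : option nat :=
  if y == 0 then None else Some (get [set k | (2 <= k)%N /\ Iset R k y]).

Definition Psi (R : realType) (y : R) : R :=
  if kappa y is Some k then 4 * (y - tpt R k) else 0.

(* kappa_n = kappa o Psi^n; Psi maps [0, 2/3] to itself (see [Psi_itv]). *)
Definition kappa_ (R : realType) (n : nat) (y : R) : option nat :=
  kappa (iter n (@Psi R) y).

(* l |-> 2^(-l), with 2^(-infinity) = 0. *)
Definition pow2N (R : realType) (l : option nat) : R :=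
  if l is Some m then 2 ^- m else 0.

Lemma tptS (R : realType) (k : nat) : (0 < k)%N -> tpt R k.+1 <= tpt R k.
Proof.
move=> k0; rewrite /tpt exprS invfM mulrA ler_wpM2r ?invr_ge0 ?exprn_ge0//.
by rewrite ler_pdivrMr// -natrM ler_nat; lia.
Qed.

Lemma tpt_le (R : realType) (j k : nat) :
  (0 < j <= k)%N -> tpt R k <= tpt R j.
Proof.
move=> /andP[j0]; elim: k => [|k IH]; first by lia.
rewrite leq_eqVlt => /orP[/eqP<-//|jk].
by apply: le_trans (IH _) => //; apply: tptS; lia.
Qed.

Lemma tpt_small (R : realType) (y : R) : 0 < y -> exists k, tpt R k.+2 <= y.
Proof.
move=> y0; pose n := Num.truncn (2 / y); exists (2 * n)%N.
have -> : (2 * n).+2 = (2 * n.+1)%N by lia.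
have hm : 2 / y < n.+1%:R by apply: truncnS_gt.
have h2 : n.+1%:R <= 2 ^+ n.+1 :> R by rewrite -natrX ler_nat ltnW// ltn_expl.
have h1 : n.+1%:R ^+ 2 <= 2 ^+ (2 * n.+1) :> R.
  by rewrite mulnC exprM lerXn2r// nnegrE ?exprn_ge0.
rewrite /tpt ler_pdivrMr ?exprn_gt0//.
apply: (@le_trans _ _ (y * n.+1%:R ^+ 2)); last by rewrite ler_pM2l.
rewrite natrM expr2 mulrA ler_wpM2r ?ler0n//.
by move: hm; rewrite ltr_pdivrMr// => /ltW; rewrite mulrC.
Qed.

Lemma Iset_uniq (R : realType) (y : R) (j k : nat) :
  (2 <= j)%N -> (2 <= k)%N -> Iset R j y -> Iset R k y -> j = k.
Proof.
have t2 : tpt R 2 = 1 / 2 by rewrite /tpt; field.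
have lo i : Iset R i y -> tpt R i <= y.
  rewrite /Iset; case: eqP => [->|_]; rewrite /= in_itv /= => /andP[];
  by rewrite ?t2.
have hi i : i != 2%N -> Iset R i y -> y < tpt R i.-1.
  by rewrite /Iset => /negbTE->; rewrite /= in_itv /= => /andP[].
wlog jk : j k / (j <= k)%N.
  move=> H; case: (leqP j k) => [|/ltnW] ?; first exact: H.
  by move=> *; symmetry; exact: H.
move=> j2 k2 Ij Ik; apply/eqP; rewrite eqn_leq jk /= leqNgt; apply/negP => ltjk.
have : y < y.
  apply: lt_le_trans (hi _ _ Ik) _; first by lia.
  by apply: le_trans (lo _ Ij); apply: tpt_le; lia.
by rewrite ltxx.
Qed.

Lemma Iset_cover (R : realType) (y : R) :
  0 < y <= 2 / 3 -> exists k, (2 <= k)%N /\ Iset R k y.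
Proof.
move=> /andP[y0 y1].
have [yh|yh] := leP (1 / 2) y.
  by exists 2%N; split => //; rewrite /Iset eqxx /= in_itv /= yh y1.
have [k hk] := tpt_small y0; elim: k hk => [|k IH] hk.
  by move: (le_lt_trans hk yh); rewrite /tpt; lra.
have [/IH//|lt] := leP (tpt R k.+2) y.
by exists k.+3; split => //; rewrite /Iset /= in_itv /= hk lt.
Qed.

Lemma kappaP (R : realType) (y : R) (k : nat) :
  0 < y <= 2 / 3 -> kappa y = Some k <-> (2 <= k)%N /\ Iset R k y.
Proof.
move=> hy; have [j hj] := Iset_cover hy.
have [g2 gy] := @getI _ [set k | (2 <= k)%N /\ Iset R k y] j hj.
rewrite /kappa gt_eqF; last by case/andP: hy.
split=> [[<-]|[k2 ky]]; first by split.
by congr (Some _); exact: Iset_uniq g2 k2 gy ky.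
Qed.

Lemma Psi_itv (R : realType) (y : R) :
  0 <= y <= 2 / 3 -> 0 <= Psi y <= 2 / 3.
Proof.
rewrite /Psi => /andP[]; rewrite le_eqVlt => /orP[/eqP<- _|y0 y1].
  by rewrite /kappa eqxx; lra.
have hy : 0 < y <= 2 / 3 by rewrite y0.
have [k hk] := Iset_cover hy; have [k2 +] := hk.
move/(kappaP k hy): hk => ->; rewrite /Iset.
case: eqP => [->|/eqP k3]; rewrite /= in_itv /= => /andP[lo hi].
  by rewrite /tpt; lra.
have [m km] : exists m, k = m.+3 by exists (k - 3)%N; lia.
rewrite km /= in lo hi *.
have : 4 * (tpt R m.+2 - tpt R m.+3) <= 1 / 2.
  have -> : 4 * (tpt R m.+2 - tpt R m.+3) = tpt R m.+1.
    rewrite /tpt !exprS -(addn3 m) -(addn2 m) -(addn1 m) !natrD; field.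
    by rewrite expf_neq0.
  by apply: le_trans (@tpt_le R 1 m.+1 _) _ => //; rewrite /tpt; lra.
by move: lo hi; lra.
Qed.

(* Main.v *)
Require Import Defs.
From mathcomp Require Import all_boot all_order all_algebra.
From mathcomp Require Import all_classical all_reals all_analysis.
From mathcomp Require Import zify ring lra.
Import Order.TTheory GRing.Theory Num.Theory.
Import numFieldNormedType.Exports.
Local Open Scope classical_set_scope.
Local Open Scope ring_scope.

(** Write [X y] for the sum attached to [y].  The expansion satisfies
    [k_(n+1) >= k_n - 1], which gives [X (Psi y) <= 2^(2-k)] for [k = kappa y].
    On that range the functional equation of [T] yields
    [T (2^(-k) + u / 4) = k / 2^k + T u / 4].  As [X y = 2^(-k) + X (Psi y) / 4]
    and [y = k / 2^k + Psi y / 4], the error [T (X y) - y] is a quarter of the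
    error at [Psi y]; errors being bounded, iteration shows that it vanishes. *)

Section Takagi.
Context {R : realType}.
Implicit Types x y u d : R.

(** * Distance to the nearest integer *)

Lemma distZ_eq x d (m : int) : d = `|x - m%:~R| ->
  (forall n : int, d <= `|x - n%:~R|) -> distZ x = d.
Proof.
move=> dm dle; apply/eqP; rewrite eq_le; apply/andP; split.
  apply: ge_inf; first by exists d => _ [n _ <-].
  by exists m.
by apply: lb_le_inf => [|_ [n _ <-]//]; exists d, m.
Qed.

(** No integer lies strictly between 0 and 1; in this form the comparison of [x] in [0, 1] with an
    arbitrary integer becomes linear arithmetic. *)
Lemma intr_le0_ge1 (m : int) : (m%:~R <= 0 :> R) \/ (1 <= m%:~R :> R).
Proof.
have [m0|m1] := leP m 0; [left|right]; first by rewrite lerz0.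
by rewrite ler1z; lia.
Qed.

Lemma distZ_left x : 0 <= x <= 1 / 2 -> distZ x = x.
Proof.
move=> hx; apply: (@distZ_eq _ _ 0) => [|m].
  by rewrite subr0 ger0_norm//; case/andP: hx.
rewrite ler_normr; apply/orP.
by case: (intr_le0_ge1 m) => hm; [left|right]; lra.
Qed.

Lemma distZ_right x : 1 / 2 <= x <= 1 -> distZ x = 1 - x.
Proof.
move=> hx; apply: (@distZ_eq _ _ 1) => [|m].
  by rewrite distrC ger0_norm//; lra.
rewrite ler_normr; apply/orP.
by case: (intr_le0_ge1 m) => hm; [left|right]; lra.
Qed.

Lemma distZDz x (m : int) : distZ (x + m%:~R) = distZ x.
Proof.
rewrite /distZ; congr inf; apply/seteqP; split => _ [n _ <-].
  by exists (n - m) => //; rewrite intrB; congr `|_|; ring.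
by exists (n + m) => //; rewrite intrD; congr `|_|; ring.
Qed.

Lemma distZ_ge0 x : 0 <= distZ x.
Proof. by apply: lb_le_inf => [|_ [n _ <-]//]; exists `|x - 0%:~R|, 0. Qed.

Lemma distZ_le1 x : distZ x <= 1.
Proof.
apply: (@le_trans _ _ `|x - (Num.floor x)%:~R|).
  by apply: ge_inf; [exists 0 => _ [n _ <-]|exists (Num.floor x)].
have := floor_le x; have := floorD1_gt x; rewrite intrD => h1 h2.
by rewrite ger0_norm; lra.
Qed.

(** * Partial sums and functional equations of the Takagi function *)

Definition takagi_sum x (N : nat) : R :=
  \sum_(0 <= n < N) (2 ^- n * distZ (2 ^+ n * x)).

Lemma takagi_sumS x N :
  takagi_sum x N.+1 = distZ x + takagi_sum (2 * x) N / 2.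
Proof.
rewrite /takagi_sum big_nat_recl// expr0 invr1 !mul1r; congr (_ + _).
rewrite mulr_suml; apply: eq_bigr => n _.
by rewrite [2 ^+ n.+1]exprSr -[2 ^+ n * 2 * x]mulrA invfM; ring.
Qed.

Lemma takagi_sum_nd x : nondecreasing_seq (takagi_sum x).
Proof.
apply/nondecreasing_seqP => n; rewrite /takagi_sum big_nat_recr//= lerDl.
by rewrite mulr_ge0 ?invr_ge0 ?exprn_ge0 ?distZ_ge0.
Qed.

Lemma takagi_sum_bound x N : 0 <= takagi_sum x N <= 2.
Proof.
elim: N x => [|N IH] x; first by rewrite /takagi_sum big_geq//; lra.
(* The constant 2 is the fixed point of b = 1 + b / 2. *)
rewrite takagi_sumS; have := IH (2 * x).
by have := distZ_ge0 x; have := distZ_le1 x; lra.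
Qed.

Lemma takagi_sum_cvg x : takagi_sum x @ \oo --> takagi x.
Proof.
apply: (@nondecreasing_is_cvgn _ (takagi_sum x)); first exact: takagi_sum_nd.
by exists 2 => _ [N _ <-]; case/andP: (takagi_sum_bound x N).
Qed.

Lemma takagi_bound x : 0 <= takagi x <= 2.
Proof.
have cx := takagi_sum_cvg x.
have ic : cvgn (takagi_sum x) by apply/cvg_ex; exists (takagi x).
rewrite -(cvg_lim (@Rhausdorff R) cx); apply/andP; split.
  by apply: limr_ge => //; near=> N; case/andP: (takagi_sum_bound x N).
by apply: limr_le => //; near=> N; case/andP: (takagi_sum_bound x N).
Unshelve. all: by end_near. Qed.

Lemma takagi_double x : takagi x = distZ x + takagi (2 * x) / 2.
Proof.
have cx : (fun N => takagi_sum x N.+1) @ \oo --> takagi x.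
  by rewrite (cvg_shiftS (takagi_sum x)); exact: takagi_sum_cvg.
apply: (cvg_unique (@Rhausdorff R) cx).
rewrite (funext (takagi_sumS x)).
apply: cvgD; first exact: cvg_cst.
by apply: cvgMl; exact: takagi_sum_cvg.
Qed.

(** Each [2 ^+ n] is an integer, so every term of the series has period 1. *)
Lemma takagiD1 x : takagi (1 + x) = takagi x.
Proof.
rewrite /takagi; congr (lim (_ @ \oo)); apply/funext => N.
apply: eq_bigr => n _; congr (_ * _).
by rewrite mulrDr mulr1 addrC -(distZDz (2 ^+ n * x) (2 ^+ n)) rmorphXn.
Qed.

Lemma pow2VS (k : nat) : 2 ^- k.+1 = 2 ^- k / 2 :> R.
Proof. by rewrite exprSr invfM mulrC. Qed.

Lemma pow2V_itv (k : nat) : 0 < (2 ^- k : R) <= 1.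
Proof. by rewrite invr_gt0 exprn_gt0//= invf_le1 ?exprn_gt0// exprn_ege1// ler1n. Qed.

(** Induction on [k] by doubling the argument. For [k = 0], two doublings lead to 1 + u, and
    periodicity applies. *)
Lemma takagi_shift (k : nat) u : 0 <= u <= 2 ^- k ->
  takagi (2 ^- k.+2 + u / 4) = tpt R k.+2 + takagi u / 4.
Proof.
elim: k u => [|k IH] u.
  rewrite expr0 invr1 => hu.
  rewrite takagi_double distZ_left; last lra.
  rewrite takagi_double distZ_right; last lra.
  have -> : 2 * (2 * (2 ^- 2 + u / 4)) = 1 + u by field.
  by rewrite takagiD1 /tpt; field.
have := pow2V_itv k; have := IH (2 * u).
rewrite /tpt !pow2VS -[k.+3]addn1 -[k.+2]addn1 !natrD => IHu k1 hu.
rewrite takagi_double distZ_left; last lra.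
(* One doubling reaches the induction hypothesis at [2 * u]. Since u <= 1/2, T(2u) = 2 (T(u) - u)
   brings the result back to [u]. *)
rewrite [_ * (_ + _)](_ : _ = 2 ^- k / 2 / 2 + 2 * u / 4); last by field.
rewrite IHu; last lra.
by rewrite [takagi u]takagi_double distZ_left; [field|lra].
Qed.

(** * Growth of the canonical expansion and the sum attached to it *)

Lemma pow2N_ge0 (l : option nat) : 0 <= pow2N R l.
Proof. by case: l => //= m; case/andP: (pow2V_itv m) => /ltW. Qed.

Lemma kappa0 : kappa (0 : R) = None.
Proof. by rewrite /kappa eqxx. Qed.

Lemma Psi0 : Psi (0 : R) = 0.
Proof. by rewrite /Psi kappa0. Qed.

Lemma Iset_ge (k : nat) (y : R) : Iset R k y -> tpt R k <= y.
Proof.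
rewrite /Iset; case: eqP => [->|_] /=; rewrite in_itv/= => /andP[+ _] //.
by rewrite /tpt; lra.
Qed.

(** This is k_1 >= k_0 - 1, stated through powers of 2 so that infinite values are covered as
    well. *)
Lemma kappa_Psi (y : R) : 0 <= y <= 2 / 3 ->
  pow2N R (kappa (Psi y)) <= 2 * pow2N R (kappa y).
Proof.
move=> hy; have hP := Psi_itv hy.
have [y0|yn0] := eqVneq y 0; first by rewrite y0 Psi0 kappa0 /= mulr0.
have [P0|Pn0] := eqVneq (Psi y) 0.
  by rewrite P0 kappa0 /= mulr_ge0 ?pow2N_ge0.
have {}hy : 0 < y <= 2 / 3 by rewrite lt_neqAle eq_sym yn0 hy.
have {}hP : 0 < Psi y <= 2 / 3 by rewrite lt_neqAle eq_sym Pn0 hP.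
have [k hk] := Iset_cover hy; have [j hj] := Iset_cover hP.
have ky := (kappaP k hy).2 hk; rewrite ky ((kappaP j hP).2 hj) /=.
have : (k <= j.+1)%N.
  case: hk => k2; rewrite /Iset; case: eqP => [->|k3] /=; first by case: hj; lia.
  rewrite in_itv/= => /andP[_ yk]; rewrite leqNgt; apply/negP => jk.
  case: hj => j2 /Iset_ge; apply/negP; rewrite -ltNge /Psi ky.
  (* For k >= 3, y < t_(k-1) gives Psi y < 4 (t_(k-1) - t_k) = t_(k-2), while j <= k - 2 would force
     t_(k-2) <= t_j <= Psi y. *)
  apply: (@lt_le_trans _ _ (tpt R k.-2)); last by apply: tpt_le; lia.
  move: yk; have -> : k = k.-2.-1.+3 by lia.
  move: (k.-2.-1) => m; rewrite /= /tpt.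
  rewrite !pow2VS -[m.+3]addn1 -[m.+2]addn1 -[m.+1]addn1 !natrD => yk.
  lra.
move=> kj; rewrite -[X in 2 * X](_ : 2 * 2 ^- k.+1 = _); last first.
  by rewrite pow2VS; field; rewrite expf_neq0.
rewrite pow2VS; have : 2 ^- j.+1 <= 2 ^- k :> R.
  by rewrite lef_pV2 ?posrE ?exprn_gt0// ler_eXn2l// ltr1n.
by rewrite pow2VS; lra.
Qed.

(* The index is shifted by one: [n] here stands for [n - 1] in the paper. *)
Definition exp_sum (y : R) (N : nat) : R :=
  \sum_(0 <= n < N) pow2N R (kappa_ n y) / 4 ^+ n.

Lemma exp_sumS y N :
  exp_sum y N.+1 = pow2N R (kappa y) + exp_sum (Psi y) N / 4.
Proof.
rewrite /exp_sum big_nat_recl// expr0 divr1; congr (_ + _).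
rewrite mulr_suml; apply: eq_bigr => n _.
by rewrite /kappa_ iterSr exprSr invfM mulrA.
Qed.

(** With p = 2^(-k_0), the tail is at most 2 (2 p) / 4 = p by [kappa_Psi], so the bound 2 p
    reproduces itself. *)
Lemma exp_sum_bound y N : 0 <= y <= 2 / 3 ->
  0 <= exp_sum y N <= 2 * pow2N R (kappa y).
Proof.
elim: N y => [|N IH] y hy.
  by rewrite /exp_sum big_geq// lexx/= mulr_ge0 ?pow2N_ge0.
rewrite exp_sumS; have := IH _ (Psi_itv hy); have := kappa_Psi y hy.
by have := pow2N_ge0 (kappa y); lra.
Qed.

Lemma exp_sum_nd y : nondecreasing_seq (exp_sum y).
Proof.
apply/nondecreasing_seqP => n; rewrite /exp_sum big_nat_recr//= lerDl.
by rewrite divr_ge0 ?exprn_ge0 ?pow2N_ge0.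
Qed.

Definition exp_lim (y : R) : R := lim (exp_sum y @ \oo).

Lemma exp_sum_cvg y : 0 <= y <= 2 / 3 -> exp_sum y @ \oo --> exp_lim y.
Proof.
move=> hy; apply: nondecreasing_is_cvgn; first exact: exp_sum_nd.
by exists (2 * pow2N R (kappa y)) => _ [N _ <-]; case/andP: (exp_sum_bound y N hy).
Qed.

Lemma exp_lim_bound y : 0 <= y <= 2 / 3 ->
  0 <= exp_lim y <= 2 * pow2N R (kappa y).
Proof.
move=> hy; apply/andP; split.
  apply: limr_ge; first exact: exp_sum_cvg.
  by near=> N; case/andP: (exp_sum_bound y N hy).
apply: limr_le; first exact: exp_sum_cvg.
by near=> N; case/andP: (exp_sum_bound y N hy).
Unshelve. all: by end_near. Qed.

Lemma exp_limE y : 0 <= y <= 2 / 3 ->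
  exp_lim y = pow2N R (kappa y) + exp_lim (Psi y) / 4.
Proof.
move=> hy.
have cx : (fun N => exp_sum y N.+1) @ \oo --> exp_lim y.
  by rewrite (cvg_shiftS (exp_sum y)); exact: exp_sum_cvg.
apply: (cvg_unique (@Rhausdorff R) cx).
rewrite (funext (exp_sumS y)).
apply: cvgD; first exact: cvg_cst.
by apply: cvgMl; exact: exp_sum_cvg _ (Psi_itv hy).
Qed.

(** * Contraction of the error *)

Lemma takagi0 : takagi (0 : R) = 0.
Proof.
by have := takagi_double 0; rewrite mulr0 distZ_left; lra.
Qed.

Lemma takagi_error y : 0 <= y <= 2 / 3 ->
  takagi (exp_lim y) - y = (takagi (exp_lim (Psi y)) - Psi y) / 4.
Proof.
move=> hy; have b0 := exp_lim_bound y hy.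
have bP := exp_lim_bound _ (Psi_itv hy).
have [y0|yn0] := eqVneq y 0.
  (* At 0 the bound on [exp_lim] is itself 0, which forces the sum to vanish. *)
  move: b0; rewrite y0 Psi0 kappa0 /= mulr0 => /le_anti <-.
  by rewrite takagi0; lra.
have hy' : 0 < y <= 2 / 3 by rewrite lt_neqAle eq_sym yn0 hy.
have [k hk] := Iset_cover hy'; have ky := (kappaP k hy').2 hk.
have PE : Psi y = 4 * (y - tpt R k) by rewrite {1}/Psi ky.
have := kappa_Psi y hy; rewrite exp_limE// ky /=.
move: PE; have -> : k = k.-2.+2 by case: hk; lia.
(* Here u is [exp_lim (Psi y)]; [bP] and [hP] together give u <= 4 * 2^(-k), the range that the
   shift formula requires. *)
move=> PE hP; rewrite takagi_shift; first lra.
by move: hP; rewrite !pow2VS; lra.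
Qed.

Lemma takagi_exp_lim y : 0 <= y <= 2 / 3 -> takagi (exp_lim y) = y.
Proof.
move=> hy; apply/eqP; rewrite -subr_eq0; set e := takagi _ - _.
have itv n : 0 <= iter n (@Psi R) y <= 2 / 3 by elim: n => //= n; exact: Psi_itv.
(* T takes values in [0, 2] and the iterates stay in [0, 2/3], so every error is at most 2 in
   absolute value. *)
have small n : `|e| <= 2 * 4^-1 ^+ n.
  have -> : e =
      (takagi (exp_lim (iter n (@Psi R) y)) - iter n (@Psi R) y) * 4^-1 ^+ n.
    elim: n => [|n IHn]; first by rewrite mulr1.
    by rewrite IHn takagi_error// [_ ^+ n.+1]exprS mulrA.
  rewrite normrM (ger0_norm (exprn_ge0 _ _))// ler_wpM2r ?exprn_ge0//.
  have := takagi_bound (exp_lim (iter n (@Psi R) y)).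
  by have := itv n; rewrite ler_norml; lra.
rewrite -normr_le0.
have c0 : (fun n => 2 * 4^-1 ^+ n : R) @ \oo --> (2 * 0 : R).
  apply: cvgMr; apply: cvg_expr; rewrite ger0_norm ?invr_ge0//.
  by rewrite invf_lt1 ?ltr1n.
rewrite mulr0 in c0; rewrite -(cvg_lim (@Rhausdorff R) c0).
by apply: limr_ge; [apply/cvg_ex; exists 0|near=> n; exact: small].
Unshelve. all: by end_near. Qed.

End Takagi.

Theorem mainTheorem7 (R : realType) (y : R) (hy : 0 <= y <= 2 / 3) :
  let k (n : nat) : option nat := kappa_ n y in
  let l (n : nat) : option nat :=
    omap (fun j : nat => (j + 2 * (n - 1))%N) (k (n - 1)%N) in
  let x : R := \big[+%R/0]_(1 <= n <oo) pow2N R (l n) in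
  takagi x = y.
Proof.
move=> k l x; rewrite -[RHS](takagi_exp_lim _ hy); congr (takagi _).
apply: (cvg_lim (@Rhausdorff R)).
(* The sum starts at 1, so its partial sum below N + 1 is [exp_sum y N]; after reindexing, [n - 1]
   is never truncated. *)
rewrite -(cvg_shiftS (fun N => \sum_(1 <= n < N) pow2N R (l n))).
rewrite [X in X @ _ --> _](_ : _ = exp_sum y); first exact: exp_sum_cvg.
apply/funext => N; rewrite /= big_add1; apply: eq_bigr => n _.
rewrite /l /k subn1 /=; case: (kappa_ n y) => [j|] /=; last by rewrite mul0r.
(* 2^(-(j + 2n)) = 2^(-j) / 4^n. *)
by rewrite exprD invfM exprM; congr (_ / _ ^+ _); ring.
Qed.
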